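(* Let $q$ be a prime power, $n\ge1$ an integer, $\Psi$ a transitive automorphism of the projective space $\mathbb{P}^n$ over $\mathbb{F}_q$, and $\psi:\mathbb{F}_q^n\to\mathbb{F}_q^n$ its fractional jump. Then there exist a finite index set $I$, a covering $\{U_i\}_{i\in I}$ of $\mathbb{F}_q^n$ by pairwise disjoint subsets, and a family $\{f^{(i)}\}_{i\in I}$ of rational maps of degree $1$ on $\mathbb{F}_q^n$ such that: (i) $|I|\le n+1$; (ii) $f^{(i)}$ is well defined on $U_i$ for every $i\in I$; (iii) $\psi(x)=f^{(i)}(x)$ for every $i\in I$ and every $x\in U_i$. Moreover, for each fixed $i\in I$, the $n$ components of $f^{(i)}$ all have the same denominator.
   Context: $\mathbb{P}^n$ is the set of $\mathbb{F}_q$-points of $n$-dimensional projective space over $\mathbb{F}_q$ with homogeneous coordinates $X_0,\dots,X_n$; its automorphisms are the elements of $\mathrm{PGL}_{n+1}(\mathbb{F}_q)$. A map $f:X\to X$ is transitive if for any $x,y\in X$ there is an integer $i\ge0$ with $y=f^i(x)$. Fractional jump: let $U=\{[X_0:\dots:X_n]\in\mathbb{P}^n: X_n\ne0\}$ and let $\pi:\mathbb{F}_q^n\to U$ be the bijection $(x_1,\dots,x_n)\mapsto[x_1:\dots:x_n:1]$. For $P\in U$ put $\mathfrak{J}_P=\min\{k\ge1:\Psi^k(P)\in U\}$ (always finite). The fractional jump of $\Psi$ is $\psi:\mathbb{F}_q^n\to\mathbb{F}_q^n$, $\psi(x)=\pi^{-1}\big(\Psi^{\mathfrak{J}_{\pi(x)}}(\pi(x))\big)$.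 A rational map of degree $1$ on $\mathbb{F}_q^n$ means here a tuple $f=(a_1/b_1,\dots,a_n/b_n)$ with $a_j,b_j\in\mathbb{F}_q[x_1,\dots,x_n]$ polynomials of total degree at most $1$ and $b_j\ne0$ as polynomials (a multivariate linear fractional transformation); it is well defined on a set $S$ if no $b_j$ vanishes at any point of $S$. *)

(* Defs.v *)
From HB Require Import structures.
From mathcomp Require Import all_boot all_order all_algebra.
From mathcomp Require Import generic_quotient.
From mathcomp Require Export mpoly.

Set Implicit Arguments.
Unset Strict Implicit.
Unset Printing Implicit Defensive.

Import GRing.Theory.
Local Open Scope ring_scope.
Local Open Scope quotient_scope.

Section ProjectiveSpace.
Variables (F : finFieldType) (n : nat).

(* Vectors are rows, so matrices act on the right. *)
Definition nonzero_vec : Type := {v : 'rV[F]_n.+1 | v != 0}.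

Definition proportional (u v : nonzero_vec) : bool :=
  [exists c : F, (c != 0) && (val v == c *: val u)].

Lemma proportional_refl : reflexive proportional.
Proof. by move=> u; apply/existsP; exists 1; rewrite oner_eq0 scale1r eqxx. Qed.

Lemma proportional_sym : ssrbool.symmetric proportional.
Proof.
suff sub u v : proportional u v -> proportional v u.
  by move=> u v; apply/idP/idP; apply: sub.
case/existsP=> c /andP[c0 /eqP vE]; apply/existsP; exists c^-1.
by rewrite invr_eq0 c0 vE scalerA mulVf // scale1r eqxx.
Qed.

Lemma proportional_trans : transitive proportional.
Proof.
move=> v u w /existsP[c /andP[c0 /eqP cE]] /existsP[d /andP[d0 /eqP dE]].
by apply/existsP; exists (d * c); rewrite mulf_neq0 //= dE cE scalerA.
Qed.

Canonical proportional_equiv :=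
  EquivRel proportional proportional_refl proportional_sym proportional_trans.

Definition proj_space : Type := {eq_quot proportional}.

Definition hpoint (v : 'rV[F]_n.+1) (v0 : v != 0) : proj_space :=
  \pi_({eq_quot proportional}) (exist _ v v0).

Definition hcoords (P : proj_space) : nonzero_vec :=
  repr (P : {eq_quot proportional}).

Lemma hpointP (u v : 'rV[F]_n.+1) (u0 : u != 0) (v0 : v != 0) :
  hpoint u0 = hpoint v0 <-> exists2 c : F, c != 0 & v = c *: u.
Proof.
split=> [/eqmodP /existsP[c /andP[c0 /eqP vE]] | [c c0 vE]]; first by exists c.
by apply/eqmodP/existsP; exists c; rewrite c0 /= vE.
Qed.

Lemma hcoordsK (P : proj_space) : hpoint (valP (hcoords P)) = P.
Proof.
rewrite -[RHS](reprK (P : {eq_quot proportional})) /hpoint.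
by congr (\pi _); apply: val_inj.
Qed.

Lemma hcoords_hpoint (v : 'rV[F]_n.+1) (v0 : v != 0) :
  exists2 c : F, c != 0 & val (hcoords (hpoint v0)) = c *: v.
Proof. exact/(hpointP v0 (valP (hcoords _)))/esym/hcoordsK. Qed.

Lemma mulmx_unit_neq0 (A : 'M[F]_n.+1) (v : 'rV[F]_n.+1) :
  A \in unitmx -> v != 0 -> v *m A != 0.
Proof.
by move=> uA; apply: contraNneq => vA0; rewrite -(mulmxK uA v) vA0 mul0mx.
Qed.

Definition induced_map (A : 'M[F]_n.+1) (uA : A \in unitmx) (P : proj_space) :
    proj_space :=
  hpoint (mulmx_unit_neq0 uA (valP (hcoords P))).

Lemma induced_mapE (A : 'M[F]_n.+1) (uA : A \in unitmx) (v : 'rV[F]_n.+1)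
    (v0 : v != 0) :
  induced_map uA (hpoint v0) = hpoint (mulmx_unit_neq0 uA v0).
Proof.
have [c c0 vE] := hcoords_hpoint v0; apply/hpointP; exists c^-1.
  by rewrite invr_eq0.
by rewrite vE -scalemxAl scalerA mulVf // scale1r.
Qed.

(* The action of PGL on points is faithful, so its elements are identified with
   the self-maps of projective space induced by invertible matrices. *)
Definition proj_automorphism (Psi : proj_space -> proj_space) : Prop :=
  exists (A : 'M[F]_n.+1) (uA : A \in unitmx), Psi =1 induced_map uA.

Definition in_affine_chart (P : proj_space) : bool :=
  val (hcoords P) 0 ord_max != 0.

Lemma in_affine_chartE (v : 'rV[F]_n.+1) (v0 : v != 0) :
  in_affine_chart (hpoint v0) = (v 0 ord_max != 0).
Proof.
rewrite /in_affine_chart; have [c c0 ->] := hcoords_hpoint v0.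
by rewrite mxE mulf_eq0 (negPf c0).
Qed.

(* (x_1, ..., x_n, 1): the indices other than ord_max are the lift ord_max j. *)
Definition homogenize (x : 'rV[F]_n) : 'rV[F]_n.+1 :=
  \row_i (if unlift ord_max i is Some j then x 0 j else 1).

Lemma homogenize_neq0 (x : 'rV[F]_n) : homogenize x != 0.
Proof.
apply/eqP => /rowP/(_ ord_max); rewrite !mxE unlift_none.
by apply/eqP; rewrite oner_eq0.
Qed.

Definition affine_embed (x : 'rV[F]_n) : proj_space :=
  hpoint (homogenize_neq0 x).

(* The inverse of affine_embed on the chart; junk outside it. *)
Definition affine_coords (P : proj_space) : 'rV[F]_n :=
  let X := val (hcoords P) in \row_j (X 0 (lift ord_max j) / X 0 ord_max).

Lemma affine_embed_in_chart (x : 'rV[F]_n) : in_affine_chart (affine_embed x).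
Proof. by rewrite in_affine_chartE mxE unlift_none oner_eq0. Qed.

Lemma affine_embedK : cancel affine_embed affine_coords.
Proof.
move=> x; apply/rowP => j; rewrite mxE.
have [c c0 ->] := hcoords_hpoint (homogenize_neq0 x).
by rewrite !mxE liftK unlift_none mulr1 mulrC mulKf.
Qed.

Lemma affine_coordsK : {in in_affine_chart, cancel affine_coords affine_embed}.
Proof.
move=> P; rewrite unfold_in => PU; rewrite -[RHS]hcoordsK.
apply/hpointP; exists (val (hcoords P) 0 ord_max) => //.
apply/rowP => i; rewrite !mxE.
by case: unliftP => [j ->|->]; rewrite ?mulr1 // mxE mulrC divfK.
Qed.

Lemma return_exists (Psi : proj_space -> proj_space) (P : proj_space) :
    proj_automorphism Psi -> in_affine_chart P ->
  exists k : nat, (0 < k)%N && in_affine_chart (iter k Psi P).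
Proof.
case=> A [uA PsiE] PU; pose f (v : 'rV[F]_n.+1) := v *m A.
have f_inj : injective f by apply: can_inj (mulmxK uA).
have [v0 PE] : exists v0 : val (hcoords P) != 0, P = hpoint v0.
  by exists (valP (hcoords P)); rewrite hcoordsK.
have iterE k : exists w0, iter k Psi P = @hpoint (iter k f (val (hcoords P))) w0.
  elim: k => [|k [w0 IHk]] /=; first by exists v0.
  exists (mulmx_unit_neq0 uA w0).
  by rewrite IHk PsiE induced_mapE.
exists (order f (val (hcoords P))); rewrite order_gt0 /=.
have [w0 ->] := iterE (order f (val (hcoords P))).
by rewrite in_affine_chartE iter_order.
Qed.

Section FractionalJump.
Variables (Psi : proj_space -> proj_space) (autPsi : proj_automorphism Psi).

Definition jump_time (x : 'rV[F]_n) : nat :=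
  ex_minn (return_exists autPsi (affine_embed_in_chart x)).

Definition frac_jump (x : 'rV[F]_n) : 'rV[F]_n :=
  affine_coords (iter (jump_time x) Psi (affine_embed x)).

End FractionalJump.

End ProjectiveSpace.

Definition transitive_map (X : Type) (f : X -> X) : Prop :=
  forall x y : X, exists i : nat, y = iter i f x.

Section LinearFractional.
Variables (F : finFieldType) (n : nat).

(* msize is the total degree plus one, and 0 for the zero polynomial. *)
Record lin_frac_map := LinFracMap {
  lf_num : 'I_n -> {mpoly F[n]};
  lf_den : 'I_n -> {mpoly F[n]};
  lf_num_deg : forall j, (msize (lf_num j) <= 2)%N;
  lf_den_deg : forall j, (msize (lf_den j) <= 2)%N;
  lf_den_neq0 : forall j, lf_den j != 0
}.

Definition lf_well_defined (f : lin_frac_map) (S : {set 'rV[F]_n}) : Prop :=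
  forall x, x \in S -> forall j, (lf_den f j).@[x 0] != 0.

Definition lf_eval (f : lin_frac_map) (x : 'rV[F]_n) : 'rV[F]_n :=
  \row_j ((lf_num f j).@[x 0] / (lf_den f j).@[x 0]).

End LinearFractional.

(* Main.v *)
Require Import Defs.
From mathcomp Require Import all_boot all_order all_algebra.

(** Lift [Psi] to an invertible matrix [A] acting on row vectors of length
    [n + 1].  After [k] steps the point with homogeneous coordinates
    [v = (x, 1)] has coordinates [v A^k], so on the set [U_k] of the [x] whose
    jump time is [k] the fractional jump divides the first [n] entries of
    [v A^k] by the last one.  These entries are polynomials of degree at most
    one in [x] ([meval_affine_poly]); the last one is the common denominator, nonzero
    on [U_k] by definition of the jump time, and nonzero as a polynomial
    because a column of [A^k] is nonzero ([affine_poly_neq0]).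

    What bounds the number of pieces is that jump times never exceed [n + 1].
    By Cayley-Hamilton, and because the constant coefficient of the
    characteristic polynomial is the nonzero determinant up to sign, [v] is a
    linear combination of [v A, ..., v A^(n + 1)].  Were all these vectors in
    the hyperplane at infinity, [v] would be there as well
    ([orbit_leaves_hyperplane]).  So [U_1, ..., U_(n + 1)] cover the affine
    space, and they are disjoint since each [x] has a single jump time. *)

Section AffinePolynomials.
Local Set Implicit Arguments.
Local Unset Strict Implicit.
Import GRing.Theory.
Local Open Scope ring_scope.
Variables (F : finFieldType) (n : nat).

(** The linear form with coefficient column [c], dehomogenized by setting the
    last coordinate to one. *)
Definition affine_poly (c : 'cV[F]_n.+1) : {mpoly F[n]} :=
  (c ord_max 0)%:MP + \sum_(j < n) c (lift ord_max j) 0 *: 'X_j.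

Lemma msize_affine_poly (c : 'cV[F]_n.+1) : (msize (affine_poly c) <= 2)%N.
Proof.
apply: (leq_trans (msizeD_le _ _)); rewrite geq_max; apply/andP; split.
  by rewrite msizeC; case: (_ != _).
apply: (leq_trans (msize_sum _ _ _)); apply/bigmax_leqP => j _.
by apply: (leq_trans (msizeZ_le _ _)); rewrite msizeX mdeg1.
Qed.

Lemma meval_affine_poly (c : 'cV[F]_n.+1) (x : 'rV[F]_n) :
  (affine_poly c).@[x 0] = (homogenize x *m c) 0 0.
Proof.
rewrite /affine_poly mevalD mevalC mxE big_ord_recr /= addrC.
rewrite mxE unlift_none mul1r (raddf_sum (meval (x 0))); congr (_ + _).
apply: eq_bigr => j _.
have -> : widen_ord (leqnSn n) j = lift ord_max j.
  by apply: val_inj; rewrite /= /bump leqNgt ltn_ord.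
by rewrite /= mevalZ mevalXU !mxE liftK mulrC.
Qed.

Lemma affine_poly_neq0 (c : 'cV[F]_n.+1) : c != 0 -> affine_poly c != 0.
Proof.
apply: contraNneq => p0; apply/eqP/matrixP => i z; rewrite ord1 mxE {z}.
case: (unliftP ord_max i) => [j ->|->].
  move/(congr1 (mcoeff U_(j))): p0; rewrite mcoeff0 mcoeffD mcoeffC.
  rewrite mnm1_eq0 mulr0 add0r (raddf_sum (mcoeff _)) (bigD1 j) //= big1.
    by rewrite addr0 /= mcoeffZ mcoeffX eqxx mulr1.
  by move=> i' /negPf ne; rewrite /= mcoeffZ mcoeffX eq_mnm1 ne mulr0.
move/(congr1 (mcoeff 0%MM)): p0; rewrite mcoeff0 mcoeffD mcoeffC eqxx mulr1.
rewrite (raddf_sum (mcoeff _)) big1 ?addr0 // => j _.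
by rewrite /= mcoeffZ mcoeffX mnm1_eq0 mulr0.
Qed.

End AffinePolynomials.

Section Orbits.
Local Set Implicit Arguments.
Local Unset Strict Implicit.
Import GRing.Theory.
Local Open Scope ring_scope.

(** Cayley-Hamilton writes [det A *: v] as a combination of the [v A^(k+1)]
    with [k <= n]; hence they cannot all lie in the hyperplane [_ *m c = 0]
    unless [v] does. *)
Lemma orbit_leaves_hyperplane (F : fieldType) (n : nat) (A : 'M[F]_n.+1)
    (v : 'rV[F]_n.+1) (c : 'cV[F]_n.+1) :
  A \in unitmx -> v *m c != 0 ->
  exists k : 'I_n.+1, v *m A ^+ k.+1 *m c != 0.
Proof.
move=> uA vc; apply/existsP; apply: contraNT vc; rewrite negb_exists.
move=> /forallP vanish; have := Cayley_Hamilton A.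
rewrite /horner_mx /horner_morph.
rewrite (@horner_coef_wide _ n.+2); last by rewrite size_map_poly size_char_poly.
move/(congr1 (fun M => v *m M *m c)); rewrite mulmx0 mul0mx.
rewrite big_ord_recl /= expr0 mulr1 mulmxDr mulmxDl coef_map /=.
rewrite mulmx_sumr mulmx_suml big1 => [|k _]; last first.
  rewrite -[bump 0 k]/k.+1 coef_map /= -[_ * _]/(_ *m _) mul_scalar_mx -scalemxAr.
  by rewrite -scalemxAl; have /negPn/eqP -> := vanish k; rewrite scaler0.
rewrite addr0 mul_mx_scalar -scalemxAl char_poly_det => /eqP.
rewrite scaler_eq0 mulf_eq0 signr_eq0 /= => /orP[/eqP detA0|//].
by move: uA; rewrite unitmxE detA0 unitr0.
Qed.

Variables (F : finFieldType) (n : nat).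
Variables (Psi : proj_space F n -> proj_space F n).
Variables (A : 'M[F]_n.+1) (uA : A \in unitmx).
Hypothesis PsiE : Psi =1 induced_map uA.

Lemma iter_hpoint (k : nat) (v : 'rV[F]_n.+1) (v0 : v != 0) :
  exists w0 : v *m A ^+ k != 0, iter k Psi (hpoint v0) = hpoint w0.
Proof.
elim: k => [|k [w0 IHk]] /=.
  have w0 : v *m A ^+ 0 != 0 by rewrite expr0 mulmx1.
  by exists w0; apply/hpointP; exists 1; rewrite ?oner_eq0 // mulmx1 scale1r.
have w1 : v *m A ^+ k.+1 != 0.
  by rewrite exprSr mulmxA mulmx_unit_neq0.
exists w1; rewrite IHk PsiE induced_mapE; apply/hpointP; exists 1.
  by rewrite oner_eq0.
by rewrite scale1r exprSr mulmxA.
Qed.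

Lemma affine_coords_hpoint (v : 'rV[F]_n.+1) (v0 : v != 0) :
  affine_coords (hpoint v0) =
    \row_j (v 0 (lift ord_max j) / v 0 ord_max).
Proof.
apply/rowP => j; rewrite !mxE; have [c c0 ->] := hcoords_hpoint v0.
by rewrite !mxE -mulf_div divff // mul1r.
Qed.

Lemma iter_in_chart (k : nat) (x : 'rV[F]_n) :
  in_affine_chart (iter k Psi (affine_embed x)) =
    ((homogenize x *m A ^+ k) 0 ord_max != 0).
Proof.
by have [w0 ->] := iter_hpoint k (homogenize_neq0 x); rewrite in_affine_chartE.
Qed.

Lemma meval_col_expr (k : nat) (i : 'I_n.+1) (x : 'rV[F]_n) :
  (affine_poly (col i (A ^+ k))).@[x 0] = (homogenize x *m A ^+ k) 0 i.
Proof. by rewrite meval_affine_poly colE mulmxA -colE mxE. Qed.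

Lemma col_expr_neq0 (k : nat) (i : 'I_n.+1) : col i (A ^+ k) != 0.
Proof.
have uAk : A ^+ k \in unitmx by rewrite -[_ \in _]/(_ \is a GRing.unit) unitrX.
apply/eqP => c0; have := congr1 (col i) (mulVmx uAk).
rewrite colE -mulmxA -colE c0 mulmx0 => /matrixP/(_ i 0); rewrite !mxE eqxx => /eqP.
by rewrite eq_sym oner_eq0.
Qed.

Definition iterate_frac (k : nat) : lin_frac_map F n :=
  LinFracMap
    (fun j => msize_affine_poly (col (lift ord_max j) (A ^+ k)))
    (fun=> msize_affine_poly (col ord_max (A ^+ k)))
    (fun=> affine_poly_neq0 (col_expr_neq0 k ord_max)).

Lemma affine_coords_iter (k : nat) (x : 'rV[F]_n) :
  affine_coords (iter k Psi (affine_embed x)) = lf_eval (iterate_frac k) x.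
Proof.
have [w0 ->] := iter_hpoint k (homogenize_neq0 x).
by rewrite affine_coords_hpoint; apply/rowP => j; rewrite !mxE !meval_col_expr !mxE.
Qed.

Variable autPsi : proj_automorphism Psi.

Lemma jump_time_gt0 (x : 'rV[F]_n) : (0 < jump_time autPsi x)%N.
Proof. by rewrite /jump_time; case: ex_minnP => k /andP[]. Qed.

Lemma jump_time_in_chart (x : 'rV[F]_n) :
  in_affine_chart (iter (jump_time autPsi x) Psi (affine_embed x)).
Proof. by rewrite /jump_time; case: ex_minnP => k /andP[]. Qed.

(** The hyperplane at infinity is the kernel of the last coordinate column,
    and an embedded affine point is off it. *)
Lemma jump_time_le (x : 'rV[F]_n) : (jump_time autPsi x <= n.+1)%N.
Proof.
have lastE (v : 'rV[F]_n.+1) :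
    (v *m delta_mx ord_max 0 != 0 :> 'cV_1) = (v 0 ord_max != 0).
  rewrite -colE; congr (~~ _); apply/eqP/eqP => [/matrixP/(_ 0 0)|v0].
    by rewrite !mxE.
  by apply/matrixP => i j; rewrite !ord1 !mxE.
have [|k] := @orbit_leaves_hyperplane _ _ _ (homogenize x)
    (delta_mx ord_max 0) uA.
  by rewrite lastE mxE unlift_none oner_eq0.
rewrite lastE -iter_in_chart => kU.
rewrite /jump_time; case: ex_minnP => m _ /(_ k.+1) min_m.
by apply: leq_trans (ltn_ord k); apply: min_m; rewrite kU.
Qed.

End Orbits.

Theorem mainTheorem5 (F : finFieldType) (n : nat) (hn : (1 <= n)%N)
    (Psi : proj_space F n -> proj_space F n)
    (autPsi : proj_automorphism Psi) (transPsi : transitive_map Psi) :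
  exists (I : finType) (U : I -> {set 'rV[F]_n}) (f : I -> lin_frac_map F n),
    (\bigcup_(i : I) U i = [set: 'rV[F]_n]) /\
    (forall i j : I, i != j -> [disjoint U i & U j]) /\
    (#|I| <= n.+1)%N /\
    (forall i : I, lf_well_defined (f i) (U i)) /\
    (forall (i : I) (x : 'rV[F]_n), x \in U i ->
       frac_jump autPsi x = lf_eval (f i) x) /\
    (forall (i : I) (j k : 'I_n), lf_den (f i) j = lf_den (f i) k).
Proof.
have [A [uA PsiE]] := autPsi.
(* Jump times range over 1, ..., n + 1: the index i stands for jump time i + 1. *)
exists 'I_n.+1, (fun i : 'I_n.+1 => [set x | jump_time autPsi x == i.+1]).
exists (fun i : 'I_n.+1 => iterate_frac uA i.+1).
split.
  apply/setP => x; rewrite inE; apply/bigcupP.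
  have gt0 := jump_time_gt0 autPsi x.
  have le := jump_time_le PsiE autPsi x.
  have lt : ((jump_time autPsi x).-1 < n.+1)%N by rewrite prednK.
  by exists (Ordinal lt) => //; rewrite inE /= prednK.
split.
  move=> i j ij; rewrite -setI_eq0; apply/eqP/setP => x; rewrite !inE.
  apply: contraNF ij => /andP[/eqP -> /eqP[ij]].
  by apply/eqP/val_inj.
split; first by rewrite card_ord.
split.
  move=> i x; rewrite inE => /eqP xi j.
  rewrite /= meval_col_expr -(iter_in_chart PsiE) -xi.
  exact: jump_time_in_chart.
split=> // i x; rewrite inE => /eqP xi.
by rewrite /frac_jump xi (affine_coords_iter PsiE).
Qed.
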